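(* Let $f(x)=a_1x+a_2x^2+\cdots+a_kx^k+\cdots$ be a formal power series with coefficients in a field and $a_1\neq 0$, and for $n\in\mathbb N$, $n\ge 1$, write its $n$-fold composition as $f^{(n)}(x)=f_1^{(n)}x+f_2^{(n)}x^2+\cdots+f_k^{(n)}x^k+\cdots$. Then for all integers $n\ge 1$ and $k\ge 1$: $$f_k^{(n)}=\begin{cases} a_1^n & \text{if } k=1,\\[4pt] a_2a_1^{n-1}\sum\limits_{i=0}^{n-1}a_1^{i} & \text{if } k=2,\\[6pt] a_ka_1^{n-1}\sum\limits_{i=0}^{n-1}a_1^{(k-1)i}+\sum\limits_{\alpha=2}^{k-1}A_{\alpha,k} & \text{if } k\ge 3,\end{cases}$$ where, for $2\le\alpha\le k-1$, $A_{\alpha,k}$ (which depends on $n$) is a polynomial in the variables $a_1,a_2,\ldots,a_{k-\alpha+1}$ given by $$A_{\alpha,k}=\sum\Big(a_1^{n-\alpha}\,a_1^{(j_0-1)i_0}a_1^{(j_1-1)i_1}\cdots a_1^{(j_{\alpha-1}-1)i_{\alpha-1}}\Big)\cdot\Big(a_{j_{\alpha-1}}\,a_{j_{\alpha-2}}^{[j_{\alpha-1}]}\cdots a_{j_{m-1}}^{[j_m]}\cdots a_{j_1}^{[j_2]}\,a_{j_0}^{[j_1]}\Big),$$ the sum being taken over all integer sequences $(i_0,i_1,\ldots,i_{\alpha-1},j_0,j_1,\ldots,j_{\alpha-1})$ such that $$0\le i_0\le n-\alpha,\qquad 0\le i_m\le n-\alpha-i_0-i_1-\cdots-i_{m-1}\quad(1\le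 m\le\alpha-1),$$ $$j_0=k>j_1>j_2>\cdots>j_{\alpha-1}\ge 2 .$$
   Context: The $n$-fold composition is defined by $f^{(1)}(x)=f(x)$ and $f^{(n)}(x)=f^{(n-1)}(f(x))$ for $n\ge 2$; $f_k^{(n)}$ is the coefficient of $x^k$ in $f^{(n)}(x)$. For positive integers $i,k$, $a_k^{[i]}$ denotes the coefficient of $x^k$ in the $i$-th multiplicative power $(f(x))^i$; thus $a_k^{[1]}=a_k$ and $a_k^{[i]}=0$ for $k<i$. Empty sums are $0$ (in particular $A_{\alpha,k}=0$ if $n<\alpha$). *)

(* Defs.v *)
From mathcomp Require Import all_boot all_order all_algebra.
From mathcomp Require Import mpoly.

Set Implicit Arguments.
Unset Strict Implicit.
Unset Printing Implicit Defensive.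

Import Order.TTheory GRing.Theory Num.Theory.
Local Open Scope ring_scope.

(* The series \sum_k f_k x^k is represented by its coefficient sequence f. *)
Definition fps (R : comNzRingType) : Type := nat -> R.

Definition fps_one (R : comNzRingType) : fps R := fun k => (k == 0%N)%:R.

Definition fps_X (R : comNzRingType) : fps R := fun k => (k == 1%N)%:R.

Definition fps_mul (R : comNzRingType) (f g : fps R) : fps R :=
  fun k => \sum_(i < k.+1) f i * g (k - i)%N.

(* The coefficient a_k^{[i]} of the multiplicative power f^i is
   fps_pow f i k. *)
Fixpoint fps_pow (R : comNzRingType) (f : fps R) (i : nat) : fps R :=
  if i is i'.+1 then fps_mul f (fps_pow f i') else fps_one R.

(* g(f(x)) = \sum_i g_i f(x)^i.  This is the composition only when f has zero
   constant term: then f^i has no x^k term for i > k, so that summing over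
   i <= k gives the whole coefficient of x^k. *)
Definition fps_comp (R : comNzRingType) (g f : fps R) : fps R :=
  fun k => \sum_(i < k.+1) g i * fps_pow f i k.

Fixpoint fps_iter (R : comNzRingType) (f : fps R) (n : nat) : fps R :=
  match n with
  | 0%N => fps_X R
  | 1%N => f
  | n'.+1 => fps_comp (fps_iter f n') f
  end.

(* The upper bounds on the i_m are stated in int: the difference n - alpha must
   not be truncated, so that there is no admissible pair when n < alpha. *)
Definition admissible (n alpha k : nat) (i j : nat -> nat) : bool :=
  [&& [forall m : 'I_alpha,
         (i m)%:Z <= n%:Z - alpha%:Z - \sum_(l < m) (i l)%:Z],
      j 0%N == k,
      [forall m : 'I_alpha, (0 < m)%N ==> (j m < j m.-1)%N]
    & (2 <= j alpha.-1)%N].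

(* The subtractions here are not truncated on admissible sequences. *)
Definition Aterm (R : comNzRingType) (a : fps R) (n alpha : nat)
    (i j : nat -> nat) : R :=
  (a 1%N ^+ (n - alpha) *
     \prod_(0 <= m < alpha) a 1%N ^+ ((j m - 1) * i m)) *
  (a (j alpha.-1) * \prod_(1 <= m < alpha) fps_pow a (j m) (j m.-1)).

Definition entry (d N : nat) (t : d.-tuple 'I_N) (m : nat) : nat :=
  nth 0%N [seq val x | x <- t] m.

(* Admissible sequences satisfy i_m <= n and j_m <= k, so ranging over tuples
   of ordinals loses none of them. *)
Definition A (R : comNzRingType) (a : fps R) (n alpha k : nat) : R :=
  \sum_(i : alpha.-tuple 'I_n.+1)
    \sum_(j : alpha.-tuple 'I_k.+1 | admissible n alpha k (entry i) (entry j))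
      Aterm a n alpha (entry i) (entry j).

(* Main.v *)
Require Import Defs.
From mathcomp Require Import all_boot all_order all_algebra.
From mathcomp Require Import mpoly zify ring.

Set Implicit Arguments.
Unset Strict Implicit.
Unset Printing Implicit Defensive.

Import Order.TTheory GRing.Theory Num.Theory.
Local Open Scope ring_scope.

(** Since [f^(n) = f^(n-1) o f], the coefficients of [f^(n)] form the first row
    of [M^n], where [M] is the matrix with entries [M j k = a_k^[j]].  As
    [a_0 = 0], this matrix is upper triangular, with diagonal [a_1^k].
    Expanding [M^n] therefore gives a sum over walks of length [n] from 1 to
    [k], each step of which either stays at some [j], with weight [a_1^j], or
    goes up from [j] to some [j' > j], with weight [a_(j')^[j]].  The walks
    with exactly [alpha] steps up are described by the points visited above 1,
    [k = j_0 > j_1 > ... > j_(alpha-1) >= 2], and by the number [i_m] of steps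
    spent staying at [j_m]; the other [n - alpha - \sum_m i_m] steps stay at 1.
    The weight of such a walk is the term of [A_(alpha, k)] for these indices.
    The case [alpha = 1] gives the leading terms of the formula, and there is no
    walk with [k] or more steps up.

    The sum [walk_sum a alpha n k] over the walks with [alpha] steps up is
    defined by recursion on [alpha], reading the walk backwards from [k]:
    [i] stays at [k] are preceded by a step up from some [j < k].  The two
    halves of the formula are then [fps_iter_walk_sum], proved by looking at the
    last step of the walk, and [A_walk_sum], which removes [i_0] and [j_0] from
    the index sequences.

    The polynomial behind [A_(alpha, k)] is its value at the generic series over
    [Z[X_1, ..., X_(k-alpha+1)]].  Evaluation commutes with [walk_sum]
    ([walk_sum_morph]).  A step up from [j] to [j'] involves only the
    coefficients [a_l] with [l <= j' - j + 1], and in a walk with [alpha] steps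
    up from 1 to [k] it climbs at most [k - alpha], so that no later coefficient
    of the series matters ([walk_sum_local]). *)

(** * Coefficients of multiplicative powers *)

Lemma fps_pow1 (R : comNzRingType) (a : fps R) k : fps_pow a 1 k = a k.
Proof.
rewrite /= /fps_mul big_ord_recr /= subnn /fps_one eqxx mulr1 big1 ?add0r //.
by move=> i _; rewrite subn_eq0 leqNgt ltn_ord mulr0.
Qed.

Lemma fps_pow_lt (R : comNzRingType) (a : fps R) i k :
  a 0%N = 0 -> (k < i)%N -> fps_pow a i k = 0.
Proof.
move=> a0; elim: i k => [//|i IHi] k ltki /=.
rewrite /fps_mul big1 // => -[[|l] /= ltlk] _; first by rewrite a0 mul0r.
by rewrite IHi ?mulr0 //; lia.
Qed.

Lemma fps_pow_diag (R : comNzRingType) (a : fps R) i :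
  a 0%N = 0 -> fps_pow a i i = a 1%N ^+ i.
Proof.
move=> a0; elim: i => [|i IHi]; first by rewrite expr0.
rewrite /= /fps_mul 2!big_ord_recl /= a0 mul0r add0r /bump /= subSS subn0 IHi.
rewrite exprS big1 ?addr0 // => l _.
by rewrite fps_pow_lt ?mulr0 //; have := ltn_ord l; lia.
Qed.

(** Each of the [i] factors contributes degree at least 1, so one that
    contributes more than [M] forces the total degree up to at least [i + M]. *)
Lemma fps_pow_local (R : comNzRingType) (a b : fps R) M i k :
    a 0%N = 0 -> b 0%N = 0 -> (forall l, (l <= M)%N -> a l = b l) ->
    (k < i + M)%N -> fps_pow a i k = fps_pow b i k.
Proof.
move=> a0 b0 eqab; elim: i k => [//|i IHi] k ltk /=.
apply: eq_bigr => -[[|l] /= ltlk] _; first by rewrite a0 b0 !mul0r.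
have [lt_i|ge_i] := ltnP (k - l.+1) i.
  by rewrite !fps_pow_lt // !mulr0.
by rewrite eqab ?IHi //; lia.
Qed.

Lemma fps_pow_morph (R S : comNzRingType) (phi : {rmorphism R -> S})
    (a : fps R) i k :
  phi (fps_pow a i k) = fps_pow (fun l => phi (a l)) i k.
Proof.
elim: i k => [|i IHi] k /=; first by rewrite /fps_one rmorph_nat.
by rewrite /fps_mul rmorph_sum; apply: eq_bigr => l _; rewrite rmorphM IHi.
Qed.

(** * Sums over walks *)

(** The total weight of the walks of [n] steps from 1 to [k] with [alpha] steps
    up: [i] counts the stays at [k] at the end of the walk, and [j] is the point
    from which [k] was reached.  Truncation of [n - i.+1] never occurs, because
    [i < n]. *)
Fixpoint walk_sum (R : comNzRingType) (a : fps R) (alpha n k : nat) : R :=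
  if alpha is alpha'.+1 then
    \sum_(i < n) a 1%N ^+ (k * i) *
      \sum_(j < k) fps_pow a j k * walk_sum a alpha' (n - i.+1) j
  else (k == 1%N)%:R * a 1%N ^+ n.

(** Each step up raises the position by at least 1, starting from 1. *)
Lemma walk_sum_eq0 (R : comNzRingType) (a : fps R) alpha n k :
  (k <= alpha)%N -> walk_sum a alpha n k = 0.
Proof.
elim: alpha n k => [|alpha IH] n k lek /=.
  by move: lek; rewrite leqn0 => /eqP->; rewrite mul0r.
rewrite big1 // => i _; rewrite big1 ?mulr0 // => j _.
by rewrite IH ?mulr0 //; have := ltn_ord j; lia.
Qed.

Lemma walk_sum1 (R : comNzRingType) (a : fps R) n k : (2 <= k)%N ->
  walk_sum a 1 n k =
    a k * a 1%N ^+ (n - 1) * \sum_(0 <= i < n) a 1%N ^+ ((k - 1) * i).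
Proof.
case: k => [|[|k]] // _; rewrite big_mkord mulr_sumr; apply: eq_bigr => i _.
rewrite 2!big_ord_recl /= big1 => [|j _]; last by rewrite mul0r mulr0.
rewrite addr0 mul0r add0r mul1r [fps_mul _ _ _]fps_pow1 mulrCA -exprD.
rewrite -mulrA -exprD; congr (_ * _ ^+ _).
have := ltn_ord i; nia.
Qed.

(** The last step of the walk stays at [k] or goes up to [k]. *)
Lemma walk_sumS (R : comNzRingType) (a : fps R) alpha n k :
  walk_sum a alpha.+1 n.+1 k =
    a 1%N ^+ k * walk_sum a alpha.+1 n k
    + \sum_(j < k) fps_pow a j k * walk_sum a alpha n j.
Proof.
rewrite /= big_ord_recl /= muln0 expr0 mul1r subSS subn0 addrC; congr (_ + _).
rewrite mulr_sumr; apply: eq_bigr => i _.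
by rewrite mulrA -exprD -mulnS subSS.
Qed.

(** The condition [a 0 = 0] makes [f] the composition of [x] with [f], so that
    the recursion also holds at [n = 0]. *)
Lemma fps_iterS (R : comNzRingType) (a : fps R) n k :
  a 0%N = 0 ->
  fps_iter a n.+1 k = \sum_(i < k.+1) fps_iter a n i * fps_pow a i k.
Proof.
move=> a0; case: n => [|n] //=; rewrite /fps_X.
case: k => [|k]; first by rewrite big_ord_recl big_ord0 mul0r a0 addr0.
rewrite 2!big_ord_recl /= mul0r add0r mul1r [fps_mul _ _ _]fps_pow1.
by rewrite big1 ?addr0 // => i _; rewrite mul0r.
Qed.

(** Any bound [B >= k] on the number of steps up gives the same sum; leaving it
    free lets the induction use one bound for all the points [j <= k]. *)
Lemma fps_iter_walk_sum (R : comNzRingType) (a : fps R) B n k :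
  a 0%N = 0 -> (k <= B)%N ->
  fps_iter a n k = \sum_(alpha < B.+1) walk_sum a alpha n k.
Proof.
move=> a0; elim: n k => [|n IHn] k lekB.
  rewrite big_ord_recl /= mulr1 big1 ?addr0 // => i _.
  by rewrite big_ord0.
rewrite fps_iterS // big_ord_recr /= fps_pow_diag //.
rewrite [RHS]big_ord_recl (eq_bigr _ (fun i _ => walk_sumS _ _ _ _)).
rewrite big_split /=.
rewrite -mulr_sumr addrA addrC; congr (_ + _).
  have -> : (k == 1%N)%:R * a 1%N ^+ n.+1 = a 1%N ^+ k * walk_sum a 0 n k.
    by rewrite /=; case: eqP => [->|_]; rewrite ?mul0r ?mulr0 // !mul1r exprS.
  by rewrite -mulrDr mulrC IHn // [in LHS]big_ord_recl.
rewrite exchange_big /=; apply: eq_bigr => j _; have ltjk := ltn_ord j.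
rewrite -mulr_sumr mulrC IHn; last lia.
by rewrite big_ord_recr /= walk_sum_eq0 ?addr0 //; lia.
Qed.

(** The steps up other than a given one climb at least [alpha - 1] in total, so
    that the given one climbs at most [k - alpha], which is less than [M]; its
    weight is then governed by [fps_pow_local]. *)
Lemma walk_sum_local (R : comNzRingType) (a b : fps R) M alpha n k :
    a 0%N = 0 -> b 0%N = 0 -> (forall l, (l <= M)%N -> a l = b l) ->
    (0 < M)%N -> (k < alpha + M)%N ->
  walk_sum a alpha n k = walk_sum b alpha n k.
Proof.
move=> a0 b0 eqab M0; elim: alpha n k => [|alpha IH] n k ltk /=.
  by rewrite eqab.
apply: eq_bigr => i _; rewrite eqab //; congr (_ * _).
apply: eq_bigr => j _; have ltjk := ltn_ord j.
have [leja|ltaj] := leqP j alpha; first by rewrite !walk_sum_eq0 // !mulr0.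
by rewrite IH 1?(fps_pow_local a0 b0 eqab) //; lia.
Qed.

Lemma walk_sum_morph (R S : comNzRingType) (phi : {rmorphism R -> S})
    (a : fps R) alpha n k :
  phi (walk_sum a alpha n k) = walk_sum (fun l => phi (a l)) alpha n k.
Proof.
elim: alpha n k => [|alpha IH] n k /=.
  by rewrite rmorphM rmorphXn rmorph_nat.
rewrite rmorph_sum; apply: eq_bigr => i _.
rewrite rmorphM rmorphXn rmorph_sum; congr (_ * _); apply: eq_bigr => j _.
by rewrite rmorphM fps_pow_morph IH.
Qed.

(** * Admissible index sequences as walks *)

(** Moving the subtracted terms to the other side turns the integer
    inequalities into inequalities between natural numbers. *)
Lemma admissibleE n alpha k (i j : nat -> nat) :
  admissible n alpha k i j =
  [&& [forall m : 'I_alpha, (alpha + \sum_(l < m.+1) i l <= n)%N],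
      j 0%N == k,
      [forall m : 'I_alpha, (0 < m)%N ==> (j m < j m.-1)%N]
    & (2 <= j alpha.-1)%N].
Proof.
congr (_ && _); apply: eq_forallb => m; rewrite big_ord_recr /=.
rewrite !lerBrDr -lez_nat !PoszD.
rewrite (big_morph Posz PoszD (erefl (0 : int))) addrC.
by rewrite [in LHS](addrC (i m)%:Z).
Qed.

(** Once [i_0] stays at [j_0 = k] and the step up from [j_1] are removed,
    [n - i_0 - 1] steps remain for the walk from 1 to [j_1].  The bound on
    [i_0] alone is implied by [i_0 < n] and the bound on [i_1]. *)
Lemma admissibleS n alpha k (i j : nat -> nat) :
  admissible n alpha.+2 k i j =
  [&& j 0%N == k, (i 0%N < n)%N, (j 1%N < k)%N
    & admissible (n - (i 0%N).+1) alpha.+1 (j 1%N) (i \o succn) (j \o succn)].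
Proof.
rewrite !admissibleE /= eqxx /=.
have [<-|_] := eqVneq (j 0%N) k; last by rewrite andbF.
have prefix m : (\sum_(l < m.+1) i l = i 0%N + \sum_(l < m) i l.+1)%N.
  by rewrite big_ord_recl.
rewrite /=; apply/and3P/and5P.
  case=> /forallP Hi /forallP Hj H2; split => //.
  - by have := Hi ord0; rewrite big_ord1 /=; lia.
  - exact: (Hj (lift ord0 ord0)).
  - apply/forallP => m; have := Hi (lift ord0 m).
    by rewrite /= /bump /= add1n prefix /=; lia.
  - apply/forallP => m; apply/implyP => m0; have := Hj (lift ord0 m).
    by rewrite /=; case: (nat_of_ord m) m0.
case=> ltin ltj /forallP Hi /forallP Hj H2; split => //.
- apply/forallP => m; case: (unliftP ord0 m) => [m' ->|->].
    by have := Hi m'; rewrite /= /bump /= add1n prefix /=; lia.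
  by have := Hi ord0; rewrite !big_ord1 /=; lia.
- apply/forallP => m; case: (unliftP ord0 m) => [m' ->|->] //=.
  by have := Hj m'; rewrite /=; case: (nat_of_ord m').
Qed.

(** Removing the end of the walk changes the prefactor [a_1^(n - alpha)] by
    [a_1^(i_0)], which completes [a_1^((k - 1) i_0)] to the weight [a_1^(k i_0)]
    of the stays at [k = j_0].  Admissibility ensures that the truncated
    exponents of [a_1] are true differences. *)
Lemma AtermS (R : comNzRingType) (a : fps R) n alpha (i j : nat -> nat) :
  let n' := (n - (i 0%N).+1)%N in
  (0 < j 0%N)%N ->
  admissible n' alpha.+1 (j 1%N) (i \o succn) (j \o succn) ->
  Aterm a n alpha.+2 i j =
  a 1%N ^+ (j 0%N * i 0%N) *
    (fps_pow a (j 1%N) (j 0%N) *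
     Aterm a n' alpha.+1 (i \o succn) (j \o succn)).
Proof.
move=> n' j_gt0; rewrite admissibleE => /and4P[/forallP/(_ ord0)].
rewrite big_ord1 /= => Hn _ _ _.
rewrite /Aterm big_nat_recl // [in X in _ * (_ * X)]big_nat_recl //.
rewrite !big_add1 /=.
have -> : (n - alpha.+2 = i 0 + (n' - alpha.+1))%N by lia.
have -> : (j 0 * i 0 = i 0 + (j 0 - 1) * i 0)%N by nia.
by rewrite !exprD /=; ring.
Qed.

Lemma big_tuple_cons (R : nmodType) (T : finType) d (F : d.+1.-tuple T -> R) :
  \sum_(t : d.+1.-tuple T) F t =
  \sum_(x : T) \sum_(t : d.-tuple T) F [tuple of x :: t].
Proof.
rewrite pair_big.
rewrite (reindex (fun p : T * d.-tuple T => [tuple of p.1 :: p.2])) //=.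
exists (fun t => (thead t, [tuple of behead t])) => [[x t]|t] _ /=.
  by congr (_, _); apply: val_inj.
by rewrite -tuple_eta.
Qed.

Lemma big_tuple0 (R : nmodType) (T : finType) (F : 0.-tuple T -> R) :
  \sum_(t : 0.-tuple T) F t = F [tuple].
Proof. by rewrite (big_pred1 [tuple]) // => t; apply/esym/eqP/tuple0. Qed.

(** The sum [A] with the ranges of the indices decoupled from [n] and [k]:
    removing the head of the sequences changes [n] and [k], and the types of the
    tuples must not change with them. *)
Definition chain_sum (R : comNzRingType) (a : fps R) N J n alpha k : R :=
  \sum_(i : alpha.-tuple 'I_N)
    \sum_(j : alpha.-tuple 'I_J | admissible n alpha k (entry i) (entry j))
      Aterm a n alpha (entry i) (entry j).

Lemma chain_sum1 (R : comNzRingType) (a : fps R) N J n k :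
  (k < J)%N -> (n <= N)%N -> chain_sum a N J n 1 k = walk_sum a 1 n k.
Proof.
move=> ltkJ lenN; have [k2|k2] := ltnP k 2.
  rewrite walk_sum_eq0 // /chain_sum big1 // => i _; rewrite big1 // => j.
  by case/and4P=> _ /eqP jk _ /=; rewrite jk leqNgt k2.
rewrite walk_sum1 // /chain_sum.
rewrite big_tuple_cons big_mkord mulr_sumr.
rewrite (big_ord_widen N (fun i => _ * a 1%N ^+ ((k - 1) * i)) lenN).
rewrite [RHS]big_mkcond.
apply: eq_bigr => i _; rewrite big_tuple0 big_mkcond big_tuple_cons.
rewrite (bigD1 (Ordinal ltkJ)) //= big_tuple0 big1 ?addr0 => [|j neqjk].
  rewrite admissibleE.
  have -> : [forall m : 'I_1,
      (1 + \sum_(l < m.+1) entry [tuple i] l <= n)%N] = (i < n)%N.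
    apply/forallP/idP => [/(_ ord0)|ltin m]; rewrite ?ord1 big_ord1 //.
  have -> : [forall m : 'I_1, (0 < m)%N ==>
      (entry [tuple Ordinal ltkJ] m < entry [tuple Ordinal ltkJ] m.-1)%N].
    by apply/forallP => m; rewrite ord1.
  have jk : entry [tuple Ordinal ltkJ] 0 = k by [].
  rewrite [1.-1]/= jk (eqxx k) k2 /= andbT; case: ifP => // _.
  by rewrite /Aterm big_nat1 big_geq // mulr1 /entry /=; ring.
rewrite big_tuple0 ifN // admissibleE negb_and negb_and.
by rewrite {2}/entry /= -val_eqE /= in neqjk *; rewrite neqjk orbT.
Qed.

Lemma admissible_head n alpha k (i j : nat -> nat) :
  admissible n alpha k i j -> j 0%N = k.
Proof. by case/and4P => _ /eqP. Qed.

(** The sum over [j1] has at most one nonzero term, that of [j1 = j 1].  This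
    form lets the summation over [j1] be exchanged with those over [i] and [j].
    *)
Lemma admissible_term_peel (R : comNzRingType) (a : fps R) n alpha k
    (i j : nat -> nat) :
  let n' := (n - (i 0%N).+1)%N in
  (if admissible n alpha.+2 k i j then Aterm a n alpha.+2 i j else 0) =
  if (j 0%N == k) && (i 0%N < n)%N then
    a 1%N ^+ (k * i 0%N) * \sum_(j1 < k) fps_pow a j1 k *
      (if admissible n' alpha.+1 j1 (i \o succn) (j \o succn)
       then Aterm a n' alpha.+1 (i \o succn) (j \o succn) else 0)
  else 0.
Proof.
move=> n'; rewrite admissibleS.
have [<-|//] := eqVneq (j 0%N) k; case: (i 0%N < n)%N => //=.
have [ltjk|lekj] /= := ltnP (j 1%N) (j 0%N); last first.
  rewrite big1 ?mulr0 // => j1 _.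
  case: ifP => [/admissible_head /= eqj|_]; rewrite ?mulr0 //.
  by have := ltn_ord j1; rewrite -eqj ltnNge lekj.
rewrite (bigD1 (Ordinal ltjk)) //= big1 ?addr0 => [|j1 neqj1]; last first.
  case: ifP => [/admissible_head /= eqj|_]; rewrite ?mulr0 //.
  by rewrite -val_eqE /= eqj eqxx in neqj1.
case: ifP => [adm|_]; last by rewrite !mulr0.
by rewrite AtermS // (leq_ltn_trans _ ltjk).
Qed.

(** The recursion that defines [walk_sum]. *)
Lemma chain_sumS (R : comNzRingType) (a : fps R) N J n alpha k :
  (k < J)%N -> (n <= N)%N ->
  chain_sum a N J n alpha.+2 k =
    \sum_(i < n) a 1%N ^+ (k * i) *
      \sum_(j < k) fps_pow a j k * chain_sum a N J (n - i.+1) alpha.+1 j.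
Proof.
move=> ltkJ lenN.
pose G i := a 1%N ^+ (k * i) *
  \sum_(j < k) fps_pow a j k * chain_sum a N J (n - i.+1) alpha.+1 j.
rewrite [RHS](big_ord_widen N G lenN) [RHS]big_mkcond /=.
rewrite /G /chain_sum big_tuple_cons.
apply: eq_bigr => i0 _.
(* Only the tuples j with head k contribute. *)
transitivity (\sum_(i : alpha.+1.-tuple 'I_N) \sum_(j : alpha.+1.-tuple 'I_J)
  if (i0 < n)%N then
    a 1%N ^+ (k * i0) * \sum_(j1 < k) fps_pow a j1 k *
      (if admissible (n - i0.+1) alpha.+1 j1 (entry i) (entry j)
       then Aterm a (n - i0.+1) alpha.+1 (entry i) (entry j) else 0)
  else 0).
  apply: eq_bigr => i _; rewrite big_mkcond big_tuple_cons.
  rewrite (bigD1 (Ordinal ltkJ)) //= [X in _ + X]big1 ?addr0 => [|k1 neqk1].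
    apply: eq_bigr => j _.
    by rewrite admissible_term_peel /= [entry _ 0]/= eqxx.
  apply: big1 => j _; rewrite admissible_term_peel.
  by rewrite -val_eqE /= in neqk1; rewrite (negPf neqk1).
case: ifP => _; last by rewrite big1 // => i _; rewrite big1.
transitivity (a 1%N ^+ (k * i0) * \sum_(j1 < k) \sum_(i : alpha.+1.-tuple 'I_N)
    \sum_(j : alpha.+1.-tuple 'I_J) fps_pow a j1 k *
      (if admissible (n - i0.+1) alpha.+1 j1 (entry i) (entry j)
       then Aterm a (n - i0.+1) alpha.+1 (entry i) (entry j) else 0)).
  rewrite [in RHS]exchange_big mulr_sumr; apply: eq_bigr => i _.
  by rewrite exchange_big mulr_sumr.
congr (_ * _); apply: eq_bigr => j1 _; rewrite mulr_sumr.
by apply: eq_bigr => i _; rewrite -mulr_sumr -big_mkcond.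
Qed.

Lemma chain_sum_walk_sum (R : comNzRingType) (a : fps R) N J n alpha k :
  (k < J)%N -> (n <= N)%N ->
  chain_sum a N J n alpha.+1 k = walk_sum a alpha.+1 n k.
Proof.
elim: alpha n k => [|alpha IH] n k ltkJ lenN; first exact: chain_sum1.
rewrite chain_sumS //; apply: eq_bigr => i _; congr (_ * _).
by apply: eq_bigr => j _; rewrite IH //; have := ltn_ord j; lia.
Qed.

Lemma A_walk_sum (R : comNzRingType) (a : fps R) n alpha k :
  A a n alpha.+1 k = walk_sum a alpha.+1 n k.
Proof. exact: (@chain_sum_walk_sum _ a n.+1 k.+1 n alpha k). Qed.

(** * Polynomiality *)

(** The polynomial is the value at the generic series
    [X_1 x + X_2 x^2 + ... + X_M x^M]; specialising it gives a series which
    agrees with [a] up to degree [M]. *)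
Lemma walk_sum_mpoly M n alpha k :
  (k < alpha + M)%N -> (0 < M)%N ->
  exists P : {mpoly int[M]},
  forall (R : comNzRingType) (a : fps R), a 0%N = 0 ->
    walk_sum a alpha n k =
      (map_mpoly (intr : int -> R) P).@[fun l : 'I_M => a l.+1].
Proof.
move=> ltk M0.
pose g : fps {mpoly int[M]} :=
  fun l => if l is l'.+1 then oapp (fun i : 'I_M => 'X_i) 0 (insub l') else 0.
exists (walk_sum g alpha n k) => R a a0.
pose phi := [the {rmorphism {mpoly int[M]} -> R} of
  meval (fun l : 'I_M => a l.+1) \o map_mpoly (intr : int -> R)].
rewrite -[RHS]/(phi _) walk_sum_morph.
apply: (walk_sum_local (M := M)) => //; first by rewrite !rmorph0.
case=> [|l] lel; first by rewrite a0 !rmorph0.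
by rewrite /g insubT /= map_mpolyX mevalXU.
Qed.

(** * The formula *)

Theorem theorem7p1p1 :
  (forall (K : fieldType) (a : fps K), a 0%N = 0 -> a 1%N != 0 ->
   forall n k : nat, (1 <= n)%N -> (1 <= k)%N ->
     fps_iter a n k =
       if k == 1%N then a 1%N ^+ n
       else if k == 2%N then
         a 2%N * a 1%N ^+ (n - 1) * \sum_(0 <= i < n) a 1%N ^+ i
       else
         a k * a 1%N ^+ (n - 1) * \sum_(0 <= i < n) a 1%N ^+ ((k - 1) * i)
         + \sum_(2 <= alpha < k) A a n alpha k)
  /\
  (forall n k alpha : nat, (1 <= n)%N -> (3 <= k)%N -> (2 <= alpha <= k - 1)%N ->
   exists P : {mpoly int[(k - alpha + 1)%N]},
   forall (K : fieldType) (a : fps K), a 0%N = 0 -> a 1%N != 0 ->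
     A a n alpha k =
       (map_mpoly (intr : int -> K) P).@[fun l : 'I_(k - alpha + 1) => a l.+1]).
Proof.
split=> [K a a0 _ n k _ k1|n k [|alpha] // _ _ lt_alpha_k]; last first.
  have [||P evalP] := @walk_sum_mpoly (k - alpha.+1 + 1) n alpha.+1 k; try lia.
  by exists P => K a a0 _; rewrite A_walk_sum evalP.
rewrite (fps_iter_walk_sum (B := k)) // big_ord_recr /= walk_sum_eq0 // addr0.
rewrite -(big_mkord xpredT (fun alpha => walk_sum a alpha n k)).
case: k k1 => [//|[|k]] _; first by rewrite big_nat1 /= mul1r.
rewrite big_nat_recl // big_nat_recl // walk_sum1 //.
rewrite [walk_sum _ 0 _ _]/= mul0r add0r.
case: k => [|k].
  rewrite big_geq // addr0; congr (_ * _).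
  by apply: eq_bigr => i _; rewrite mul1n.
rewrite /= !big_add1; congr (_ + _).
by apply: eq_bigr => alpha _; rewrite A_walk_sum.
Qed.
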